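(* Let $\mathcal{A}$ be a simple central maxout arrangement of $m$ maxout units of ranks $k_1,\dots,k_m\ge2$ in $\mathbb{R}^{n+1}$ with $m\ge n+1$, where for each unit the linear functions are not all equal. Then $$r(\mathcal{A})=\binom{m-1}{n}+\sum_{j=0}^{n}(-1)^{n-j}\binom{m-1-j}{n-j}\sum_{S\in\binom{[m]}{j}}r(\mathcal{A}_S).$$
   Context: Central maxout arrangement in $\mathbb{R}^{n+1}$: given $m$ maxout units $z_i(x)=\max\{A_{i,1}(x),\dots,A_{i,k_i}(x)\}$, $x\in\mathbb{R}^{n+1}$, with linear functions $A_{i,a}$, the arrangement is $\mathcal{A}=\{H^i_{ab}: i\in[m],\{a,b\}\in\binom{[k_i]}{2},\ \operatorname{codim}H^i_{ab}=1\}$, where $H^i_{ab}=\{x: A_{i,a}(x)=A_{i,b}(x)=\max_{c\in[k_i]}A_{i,c}(x)\}$. Its elements are called atoms. For $S\subseteq[m]$, $\mathcal{A}_S$ is the sub-arrangement of atoms of units $i\in S$ ($\mathcal{A}_\emptyset$ is empty). $r(\mathcal{A})$ is the number of connected components of $\mathbb{R}^{n+1}\setminus\bigcup_{H\in\mathcal{A}}H$, so $r(\mathcal{A}_\emptyset)=1$. A central maxout arrangement is simple if, for every $j$, the intersection of any $j$ atoms of (pairwise) different units is either $\{0\}$ or has codimension $j$. $[m]=\{1,\dots,m\}$ and $\binom{[m]}{j}$ is the set of $j$-element subsets of $[m]$. *)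

(* Defs.v *)
From HB Require Import structures.
From mathcomp Require Import all_boot all_order all_algebra finmap.
From mathcomp Require Import all_classical all_reals all_analysis.

Set Implicit Arguments.
Unset Strict Implicit.
Unset Printing Implicit Defensive.

Import Order.TTheory GRing.Theory Num.Theory.
Import numFieldNormedType.Exports.

Local Open Scope classical_set_scope.
Local Open Scope ring_scope.

(* Dimension of the affine hull of C: the largest d such that C contains d + 1
   affinely independent points p, p + row 0 M, ..., p + row (d - 1) M.  The
   empty set gets dimension 0, but all sets measured below contain the origin. *)
Definition affdim (R : realType) (d : nat) (C : set 'rV[R]_d) : nat :=
  \max_(e < d.+1 | `[< exists (p : 'rV[R]_d) (M : 'M[R]_(e, d)),
      [/\ C p, (forall t, C (p + row t M)) & row_free M] >]) e.

Definition codim (R : realType) (d : nat) (C : set 'rV[R]_d) : nat :=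
  (d - affdim C)%N.

(* Number of connected components of U.  The cardinal of fset_set is 0 on
   infinite sets, which does not occur for complements of finitely many
   polyhedral cones. *)
Definition ncomponents (T : topologicalType) (U : set T) : nat :=
  #|` fset_set [set connected_component U x | x in U]|%fset.

Section MaxoutArrangement.
Variables (R : realType) (d m : nat) (k : 'I_m -> nat).
Variable A : forall i : 'I_m, 'I_(k i) -> {scalar 'rV[R]_d}.

(* H^i_{ab}.  The initial value A i a x of the iterated maximum is one of its
   terms, so this is the maximum over c of A i c x. *)
Definition maxout_piece (i : 'I_m) (a b : 'I_(k i)) : set 'rV[R]_d :=
  [set x | A a x = A b x /\
           A b x = \big[Num.max/A a x]_(c < k i) A c x].

Definition atoms (i : 'I_m) : set (set 'rV[R]_d) :=
  [set H | exists a b : 'I_(k i),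
     [/\ a != b, codim (maxout_piece a b) = 1%N & H = maxout_piece a b]].

Definition arrangement (S : {set 'I_m}) : set (set 'rV[R]_d) :=
  \bigcup_(i in [set` S]) atoms i.

Definition nregions (S : {set 'I_m}) : nat :=
  ncomponents (~` \bigcup_(H in arrangement S) H).

(* The atoms are labelled by their units: two different units sharing an atom
   contribute it twice. *)
Definition simple_arrangement : Prop :=
  forall (j : nat) (u : 'I_j -> 'I_m) (H : 'I_j -> set 'rV[R]_d),
    injective u -> (forall t, atoms (u t) (H t)) ->
    let K := \bigcap_(t in [set: 'I_j]) H t in
    K = [set 0] \/ codim K = j.

End MaxoutArrangement.

(* Main.v *)
(* Give a relatively open polyhedral cone of dimension e the weight (-1)^e.  This
   Euler characteristic is additive on unions of faces of the central hyperplane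
   arrangement of all the differences A_{i,a} - A_{i,b}.  The complement of the
   atoms of the units in S is a disjoint union of r(A_S) open convex cones, so
   its Euler characteristic is (-1)^(n+1) r(A_S).  Hence the claimed identity can
   be checked face by face, and the contribution of a face F only depends on the
   number p of units whose atoms miss F.  By simplicity, n + 1 different units
   have atoms meeting in {0} only, so that p >= m - n unless F = {0}.  If
   p >= m - n the contributions agree by a binomial identity, and the face {0},
   where p = 0, accounts for the summand binom(m-1, n). *)
Require Import Defs.
From HB Require Import structures.
From mathcomp Require Import all_boot all_order all_algebra finmap.
From mathcomp Require Import all_classical all_reals all_analysis.
From mathcomp Require Import ring lra zify.

Set Implicit Arguments.
Unset Strict Implicit.
Unset Printing Implicit Defensive.

Import Order.TTheory GRing.Theory Num.Theory.
Import numFieldNormedType.Exports.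

Local Open Scope ring_scope.

(** * Alternating binomial sums *)

(** In generating functions [h] is [(1 + t) g]; both sides are the coefficient of [t ^ n] in
    [g (1 + t) ^ p.+1]. *)
Lemma sum_mul_binomialS (g h : nat -> int) (n p : nat) :
  h 0 = g 0 -> (forall i, h i.+1 = g i.+1 + g i) ->
  \sum_(j < n.+1) g (n - j)%N * 'C(p.+1, j)%:Z =
  \sum_(j < n.+1) h (n - j)%N * 'C(p, j)%:Z.
Proof.
move=> h0 hS.
transitivity (\sum_(j < n.+1) g (n - j)%N * 'C(p, j)%:Z
              + \sum_(j < n) g (n - j.+1)%N * 'C(p, j)%:Z).
  rewrite big_ord_recl [in RHS]big_ord_recl !bin0 -addrA -big_split /=.
  congr (_ + _); apply: eq_bigr => j _.
  by rewrite /bump leq0n add1n binS PoszD mulrDr.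
rewrite big_ord_recr [in RHS]big_ord_recr /= subnn h0 addrAC -big_split /=.
congr (_ + _); apply: eq_bigr => j _.
have -> : (n - j = (n - j.+1).+1)%N by rewrite subnSK.
by rewrite hS mulrDl.
Qed.

(* Both sides are the coefficient of [t ^ n] in
   [(1 + t) ^- x.+1 * (1 + t) ^+ (x.+1 + q)]. *)
Lemma sum_signed_binomial (n x q : nat) :
  \sum_(j < n.+1) (-1) ^+ (n - j) * 'C(x + (n - j), n - j)%:Z
    * 'C(x.+1 + q, j)%:Z = 'C(q, n)%:Z.
Proof.
elim: x => [|x IHx].
  (* One factor [1 + t] turns the alternating geometric series into the constant series 1. *)
  rewrite (@sum_mul_binomialS (fun i => (-1) ^+ i * 'C(0 + i, i)%:Z)
             (fun i => (i == 0)%N%:Z)) //; last first.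
    by move=> i; rewrite !add0n !binn exprS; lia.
  rewrite big_ord_recr /= subnn mul1r big1 ?add0r// => j _.
  by rewrite subn_eq0 leqNgt ltn_ord mul0r.
rewrite -IHx addSn (@sum_mul_binomialS (fun i => (-1) ^+ i * 'C(x.+1 + i, i)%:Z)
  (fun i => (-1) ^+ i * 'C(x + i, i)%:Z)) // => [|i]; first by rewrite !bin0.
rewrite exprS [in RHS]addnS binS PoszD addSnnS; lia.
Qed.

(** Writing [p = (m - n) + q] with [q <= n], the preceding identity gives ['C(q, n)], which is 1 if
    [q = n], that is [p = m], and 0 otherwise. *)
Lemma sum_signed_binomial_delta (n m p : nat) :
  (n < m)%N -> (m - n <= p <= m)%N ->
  \sum_(j < n.+1) (-1) ^+ (n - j) * 'C(m.-1 - j, n - j)%:Z * 'C(p, j)%:Z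
    = (p == m)%:Z.
Proof.
move=> nm /andP[mnp pm].
transitivity ('C(p - (m - n), n)%:Z).
  rewrite -(sum_signed_binomial n (m - n).-1); apply: eq_bigr => j _.
  have := ltn_ord j; rewrite ltnS => jn; congr (_ * _%:Z * _%:Z).
    by congr ('C(_, _)); lia.
  by congr ('C(_, _)); lia.
case: (eqVneq p m) => [->|pneq]; first by rewrite subKn ?binn // ltnW.
by rewrite bin_small //; lia.
Qed.

(** * Euler characteristic of unions of faces *)

Section EulerCharacteristic.
Variables (R : realFieldType) (V : vectType R).

Local Notation form := 'Hom(V, R^o).

Implicit Types (l : form) (x y : V) (s f : seq (form * R)) (L : seq form).

Definition sat s x : bool := all (fun c : form * R => Num.sg (c.1 x : R) == c.2) s.

(** The linear span of the cone of solutions of [s], if there are any: strict signs persist near a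
    solution, so only the equations cut down the dimension. *)
Definition zero_space s : {vspace V} :=
  \big[capv/fullv]_(c <- s | c.2 == 0) lker c.1.

(** The compactly supported Euler characteristic of the relatively open cone of solutions of [s]. *)
Definition cone_weight s : int :=
  if `[< exists x, sat s x >] then (-1) ^+ \dim (zero_space s) else 0.

Lemma sat_cat s f x : sat (s ++ f) x = sat s x && sat f x.
Proof. exact: all_cat. Qed.

Lemma zero_space_cat s f :
  zero_space (s ++ f) = (zero_space s :&: zero_space f)%VS.
Proof. by rewrite /zero_space big_cat. Qed.

Lemma cone_weight_sat s x : sat s x -> cone_weight s = (-1) ^+ \dim (zero_space s).
Proof. by move=> sx; rewrite /cone_weight asboolT //; exists x. Qed.

Lemma cone_weight_unsat s : (forall x, ~~ sat s x) -> cone_weight s = 0.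
Proof. by move=> sx; rewrite /cone_weight asboolF // => -[x]; apply/negP. Qed.

Lemma zero_space0 s l x :
  (l, 0) \in s -> x \in zero_space s -> l x = 0.
Proof.
move=> ls xs; apply/eqP; rewrite -memv_ker; apply: (subvP _ x xs).
by rewrite /zero_space (big_rem _ ls) /= eqxx capvSl.
Qed.

Lemma zero_spaceP s x :
  reflect (forall c, c \in s -> c.2 = 0 -> c.1 x = 0) (x \in zero_space s).
Proof.
apply: (iffP idP) => [xs [l e] ls /= e0|].
  by apply: zero_space0 xs; rewrite -e0.
rewrite /zero_space; elim: s => [|c s IHs] H; first by rewrite big_nil memvf.
have xs : x \in zero_space s by apply: IHs => c' c's; apply: H; rewrite inE c's orbT.
rewrite big_cons; case: eqP => // c0.
by rewrite memv_cap memv_ker xs andbT; apply/eqP/H; rewrite ?mem_head.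
Qed.

Lemma sg_perturb (a b : R) : a != 0 ->
  exists2 e : R, 0 < e & forall t, `|t| <= e -> Num.sg (a + t * b) = Num.sg a.
Proof.
(* This bound gives [|t b| <= |a| |b| / (2 (1 + |b|)) < |a|]; the summand 1 covers [b = 0]. *)
move=> a0; exists (`|a| / (2 * (1 + `|b|))) => [|t].
  by rewrite divr_gt0 ?normr_gt0 ?mulr_gt0 // ltr_pwDl.
have b1 : 0 < 2 * (1 + `|b|) by rewrite mulr_gt0 // ltr_pwDl.
rewrite ler_pdivlMr // => te.
have tb : `|t * b| < `|a|.
  have : 0 < `|a| by rewrite normr_gt0.
  have := normr_ge0 b; have := normr_ge0 t; rewrite normrM; nra.
move: tb; rewrite ltr_norml; have [|a1|->] := ltgtP a 0.
- move=> a1 /andP[_ ]; rewrite (ltr0_norm a1) => tb.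
  by rewrite !ltr0_sg //; lra.
- move=> /andP[+ _]; rewrite (gtr0_norm a1) => tb.
  by rewrite !gtr0_sg //; lra.
- by move=> /andP[]; rewrite normr0; lra.
Qed.

Lemma sg_perturb_all (T : eqType) (r : seq T) (g h : T -> R) :
  {in r, forall c, g c != 0} ->
  exists2 e : R, 0 < e &
    {in r, forall c t, `|t| <= e -> Num.sg (g c + t * h c) = Num.sg (g c)}.
Proof.
elim: r => [|c r IHr] H; first by exists 1.
have [|e e0 He] := IHr; first by move=> ? cr; apply: H; rewrite inE cr orbT.
have [|e' e'0 He'] := @sg_perturb (g c) (h c); first by apply: H; rewrite mem_head.
exists (Num.min e e') => [|c']; first by rewrite lt_min e0.
rewrite inE => /predU1P[->|c'r] t; rewrite le_min => /andP[te te'];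
  [exact: He' | exact: He].
Qed.

(** The cone is relatively open in its span: moves along [zero_space s] preserve the equations, and
    small ones preserve the finitely many strict signs. *)
Lemma sat_perturb s x v : sat s x -> v \in zero_space s ->
  exists2 e : R, 0 < e & forall t : R, `|t| <= e -> sat s (x + t *: v).
Proof.
move=> /allP sx /zero_spaceP vs.
have [|e e0 He] := @sg_perturb_all _ [seq c <- s | c.2 != 0]
    (fun c => c.1 x) (fun c => c.1 v).
  move=> c; rewrite mem_filter => /andP[c0 /sx /eqP cx].
  by apply: contraNneq c0 => c10; rewrite -cx c10 sgr0.
exists e => // t te; apply/allP => c cs.
rewrite linearD linearZ /= -(eqP (sx c cs)).
have [c0|c0] := eqVneq c.2 0; last by rewrite He // mem_filter c0.
by rewrite vs // scaler0 addr0.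
Qed.

Lemma sg_combination (a b u v : R) : 0 < a -> 0 < b -> Num.sg v = Num.sg u ->
  Num.sg (a * u + b * v) = Num.sg u.
Proof.
move=> a0 b0; have [u0|u0|->] := ltgtP u 0.
- rewrite (ltr0_sg u0) => /eqP; rewrite sgr_cp0 => v0.
  by apply: ltr0_sg; rewrite -oppr_gt0 opprD -!mulrN addr_gt0 // mulr_gt0 // oppr_gt0.
- rewrite (gtr0_sg u0) => /eqP; rewrite sgr_cp0 => v0.
  by apply: gtr0_sg; rewrite addr_gt0 // mulr_gt0.
- by rewrite sgr0 => /eqP; rewrite sgr_eq0 => /eqP ->; rewrite !mulr0 addr0 sgr0.
Qed.

Lemma sat_convex s x y (a b : R) : 0 < a -> 0 < b -> sat s x -> sat s y ->
  sat s (a *: x + b *: y).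
Proof.
move=> a0 b0 /allP sx /allP sy; apply/allP => c cs.
have cx := eqP (sx c cs); rewrite linearD !linearZ /= -![_ *: _]/(_ * _ : R).
by rewrite sg_combination // cx // (eqP (sy c cs)).
Qed.

Lemma dim_cap_ker (U : {vspace V}) l v : v \in U -> l v != 0 ->
  \dim U = (\dim (U :&: lker l)).+1.
Proof.
move=> vU lv; rewrite -(limg_ker_dim l U) -addn1; congr (_ + _)%N.
apply/eqP; rewrite eqn_leq; apply/andP; split.
  by rewrite (leq_trans (dimvS (subvf _))) // dimvf.
rewrite lt0n dimv_eq0; apply: contraNneq lv => l0.
by rewrite -memv0 -l0 memv_img.
Qed.

Definition signs : seq R := [:: -1; 0; 1].

Lemma sat_zero_space s x : sat s x -> x \in zero_space s.
Proof.
by move=> /allP sx; apply/zero_spaceP => c /sx + c0; rewrite c0 sgr_eq0 => /eqP.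
Qed.

Lemma zero_space_cons s l e : zero_space ((l, e) :: s) =
  if e == 0 then (zero_space s :&: lker l)%VS else zero_space s.
Proof. by rewrite /zero_space big_cons /=; case: ifP => // _; rewrite capvC. Qed.

(** Only one of the three pieces is nonempty, and it is the whole cone. *)
Lemma cone_weight_split_const s l x : sat s x ->
  (forall y, sat s y -> Num.sg (l y : R) = Num.sg (l x : R)) ->
  zero_space ((l, Num.sg (l x : R)) :: s) = zero_space s ->
  \sum_(e <- signs) cone_weight ((l, e) :: s) = cone_weight s.
Proof.
move=> sx const zeq; rewrite (cone_weight_sat sx) -zeq.
rewrite -(@cone_weight_sat _ x) /= ?eqxx // (bigD1_seq (Num.sg (l x : R))) /=; first last.
- by rewrite /= !inE !negb_or andbT !lt_eqF //; lra.
- by rewrite !inE; case: sgrP; rewrite ?eqxx ?orbT.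
rewrite [X in _ + X]big1 ?addr0 // => e ne.
apply: cone_weight_unsat => y /=; apply/negP => /andP[/eqP le sy].
by rewrite -le const ?eqxx in ne.
Qed.

(** Additivity under a cut by the kernel of [l]. If the sign of [l] varies on a cone of dimension D,
    the cut leaves two pieces of dimension D and a slice of dimension D - 1, and the weights of one
    piece and of the slice cancel. *)
Lemma cone_weight_split s l :
  \sum_(e <- signs) cone_weight ((l, e) :: s) = cone_weight s.
Proof.
have [[x sx]|nos] := pselect (exists x, sat s x); last first.
  have s0 e : cone_weight (e ++ s) = 0.
    apply: cone_weight_unsat => x; rewrite sat_cat.
    by apply/negP => /andP[_ ?]; apply: nos; exists x.
  by rewrite big1 => [|e _]; [rewrite (s0 [::]) | exact: (s0 [:: (l, e)])].
have [ls|/subvPn[v vs]] := boolP (zero_space s <= lker l)%VS.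
  have s0 y : sat s y -> Num.sg (l y : R) = 0.
    move=> /sat_zero_space /(subvP ls); rewrite memv_ker => /eqP ->.
    exact: sgr0.
  apply: (cone_weight_split_const sx) => [y sy|]; first by rewrite !s0.
  by rewrite s0 // zero_space_cons eqxx; apply/capv_idPl.
rewrite memv_ker => lv.
have [[y sy ly]|no0] := pselect (exists2 y, sat s y & l y = 0); last first.
  have l0 y : sat s y -> (l y : R) != 0.
    by move=> sy; apply/eqP => ly; apply: no0; exists y.
  apply: (cone_weight_split_const sx) => [y sy|]; last first.
    by rewrite zero_space_cons sgr_eq0 (negPf (l0 _ sx)).
  apply/eqP/negPn/negP => lyx; apply: no0.
  (* For opposite signs of [l x] and [l y], this positive combination is a zero of [l] in the
     cone. *)
  exists (`|l y : R| *: x + `|l x : R| *: y).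
    by apply: sat_convex => //; rewrite normr_gt0 l0.
  rewrite linearD !linearZ /= -![_ *: _]/(_ * _ : R).
  move: lyx (l0 _ sx) (l0 _ sy).
  have [y0|y0|->] := ltgtP (l y : R) 0; have [x0|x0|->] := ltgtP (l x : R) 0;
    rewrite ?eqxx // ?(ltr0_sg y0) ?(ltr0_sg x0) ?(gtr0_sg y0) ?(gtr0_sg x0) ?eqxx //
      ?(ltr0_norm y0) ?(ltr0_norm x0) ?(gtr0_norm y0) ?(gtr0_norm x0) => _ _ _; ring.
have [e e0 He] := sat_perturb sy vs.
(* From the zero [y], a short move along [v], oriented by the sign of [l v], reaches each of the
   three signs of [l]. *)
have sat_e c : Num.sg c = c -> exists x, sat ((l, c) :: s) x.
  move=> sc; exists (y + (c * e * Num.sg (l v : R)) *: v) => /=.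
  rewrite linearD linearZ /= ly add0r -![_ *: _]/(_ * _ : R) -!mulrA.
  rewrite !sgrM (gtr0_sg e0) mul1r sgr_id -sgrM -expr2.
  rewrite [X in _ * X]gtr0_sg ?exprn_even_gt0 //.
  rewrite mulr1 sc eqxx mulrA; apply: He.
  rewrite !normrM normr_sg lv mulr1 (gtr0_norm e0) ler_piMl ?(ltW e0) //.
  by rewrite -sc normr_sg; case: (_ != _).
have [x1 s1] := sat_e (-1) (sgrN1 _); have [x2 s2] := sat_e 0 (sgr0 _).
have [x3 s3] := sat_e 1 (sgr1 _).
rewrite !big_cons big_nil (cone_weight_sat s1) (cone_weight_sat s2) (cone_weight_sat s3).
rewrite (cone_weight_sat sx) !zero_space_cons eqxx oppr_eq0 oner_eq0.
rewrite (dim_cap_ker vs lv) exprS /=; move: ((-1) ^+ _) => /= w.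
by rewrite mulN1r addKr addr0.
Qed.

(** All sign vectors on [L], infeasible ones included; those have weight 0. *)
Fixpoint faces L : seq (seq (form * R)) :=
  if L is l :: L' then [seq (l, e) :: f | e <- signs, f <- faces L'] else [:: [::]].

Lemma faces_cons l L :
  faces (l :: L) = [seq (l, e) :: f | e <- signs, f <- faces L].
Proof. by []. Qed.

Lemma sum_faces L s : \sum_(f <- faces L) cone_weight (f ++ s) = cone_weight s.
Proof.
elim: L => [|l L IHL]; first by rewrite big_seq1.
rewrite faces_cons big_allpairs_dep exchange_big /= -[RHS]IHL.
by apply: eq_bigr => f _; rewrite cone_weight_split.
Qed.

Lemma faces_cover L f l : f \in faces L -> l \in L -> exists e, (l, e) \in f.
Proof.
elim: L f => // l' L IHL g; rewrite faces_cons => /allpairsP[[e f'] /= [_ fL ->]].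
rewrite inE => /predU1P[->|/(IHL _ fL)[e' e'f]]; first by exists e; rewrite mem_head.
by exists e'; rewrite inE e'f orbT.
Qed.

(** An infeasible [f] gets the default 0, which is harmless because its weight is 0. *)
Definition face_point f : V := xget 0 [set x | sat f x].

(* The Euler characteristic of [X] when [X] is a union of faces of the
   arrangement of the kernels of [L]. *)
Definition euler L (X : V -> bool) : int :=
  \sum_(f <- faces L | X (face_point f)) cone_weight f.

Lemma sat_face_point f : cone_weight f != 0 -> sat f (face_point f).
Proof.
rewrite /cone_weight; case: asboolP => [ex _|]; last by rewrite eqxx.
exact: (@xgetPex _ 0 [set x | sat f x] ex).
Qed.

(** Each feasible face fixes the signs of all forms of [s], so it lies in the cone of [s] or misses
    it. Hence [f ++ s] has the weight of [f] or weight 0, and [sum_faces] applies. *)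
Lemma euler_sat L s : {subset [seq c.1 | c <- s] <= L} ->
  euler L (sat s) = cone_weight s.
Proof.
move=> sL; rewrite /euler -(sum_faces L s) big_mkcond /=.
apply: eq_big_seq => f fL.
have [w0|w0] := eqVneq (cone_weight f) 0.
  rewrite w0 if_same cone_weight_unsat // => x; rewrite sat_cat.
  apply/negP => /andP[fx _]; move/eqP: w0.
  by rewrite (cone_weight_sat fx) signr_eq0.
have fx := sat_face_point w0; set x := face_point f in fx *.
have signE c : c \in s -> (c.1, Num.sg (c.1 x : R)) \in f.
  move=> cs; have [e ef] := faces_cover fL (sL _ (map_f _ cs)).
  by rewrite (eqP (allP fx _ ef)).
case: ifP => [sx|/negP nsx]; last first.
  rewrite cone_weight_unsat // => y; rewrite sat_cat.
  apply/negP => /andP[/allP fy /allP sy]; apply: nsx; apply/allP => c cs.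
  by have /= /eqP <- := fy _ (signE _ cs); exact: sy.
rewrite (cone_weight_sat fx) (@cone_weight_sat _ x) ?sat_cat ?fx // zero_space_cat.
congr (_ ^+ \dim _); apply/esym/capv_idPl/subvP => y /zero_spaceP fy.
apply/zero_spaceP => c cs c0; apply: (fy _ (signE _ cs)) => /=.
by rewrite (eqP (allP sx _ cs)).
Qed.
End EulerCharacteristic.

(** * Affine dimension and kernels of linear forms *)

Section Dimension.
Variables (R : realType) (d : nat).
Implicit Types C : set 'rV[R]_d.

Lemma affdim_ge C (e : nat) (p : 'rV[R]_d) (M : 'M[R]_(e, d)) :
  C p -> (forall t, C (p + row t M)) -> row_free M -> (e <= affdim C)%N.
Proof.
move=> Cp CM Mfree.
have ed : (e < d.+1)%N by rewrite ltnS -(eqP Mfree) rank_leq_col.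
rewrite /affdim; apply: (@leq_bigmax_cond _ _ (@nat_of_ord d.+1) (Ordinal ed)).
by apply/asboolP; exists p, M.
Qed.

Lemma affdim_le C (B : nat) :
  (forall e (p : 'rV[R]_d) (M : 'M[R]_(e, d)),
    C p -> (forall t, C (p + row t M)) -> row_free M -> (e <= B)%N) ->
  (affdim C <= B)%N.
Proof.
move=> H; rewrite /affdim; apply/bigmax_leqP => e.
by move=> /asboolP[p [M [Cp CM Mfree]]]; exact: (H e p M).
Qed.

Definition coeffs (l : 'Hom('rV[R]_d, R^o)) : 'cV[R]_d :=
  \col_i (l (delta_mx 0 i) : R).

Lemma coeffsE (l : 'Hom('rV[R]_d, R^o)) e (M : 'M[R]_(e, d)) :
  M *m coeffs l = \col_t (l (row t M) : R).
Proof.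
apply/colP => t; rewrite !mxE.
rewrite [row t M]row_sum_delta linear_sum /=; apply: eq_bigr => j _.
by rewrite linearZ /= !mxE.
Qed.

Lemma hom_neq0 (l : 'Hom('rV[R]_d, R^o)) : l != 0 -> exists x, l x != 0.
Proof.
move=> l0; apply: contrapT => H; move/eqP: l0; apply; apply/lfunP => x.
by rewrite lfunE /=; apply: contrapT => /eqP lx; apply: H; exists x.
Qed.

Lemma rank_coeffs (l : 'Hom('rV[R]_d, R^o)) : l != 0 -> \rank (coeffs l) = 1%N.
Proof.
move=> /hom_neq0[x lx]; apply/eqP.
rewrite eqn_leq rank_leq_col lt0n mxrank_eq0; apply: contraNneq lx => c0.
have := coeffsE l x; rewrite c0 mulmx0 => /matrixP /(_ 0 0); rewrite !mxE.
by rewrite row_id => <-.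
Qed.

(** Differences of points of [C] lie in the kernel of [l], of rank [d.-1]. *)
Lemma affdim_hyperplane C (l : 'Hom('rV[R]_d, R^o)) : l != 0 ->
  (forall x, C x -> l x = 0) -> (affdim C <= d.-1)%N.
Proof.
move=> l0 Cl; apply: affdim_le => e p M Cp CM /eqP <-.
have Mker : (M <= kermx (coeffs l))%MS.
  apply/sub_kermxP; rewrite coeffsE; apply/colP => t; rewrite !mxE.
  have := Cl _ (CM t); rewrite linearD /= (Cl _ Cp) add0r; exact.
by rewrite (leq_trans (mxrankS Mker)) // mxrank_ker rank_coeffs // subn1.
Qed.
End Dimension.

(** * Atoms of a single unit as its points of non-smoothness *)

Section Units.
Variables (R : realType) (d m : nat) (k : 'I_m -> nat).
Variable A : forall i : 'I_m, 'I_(k i) -> {scalar 'rV[R]_d}.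
Arguments A : clear implicits.

Local Notation V := 'rV[R]_d.

Section DiffForm.
Variables (i : 'I_m) (a b : 'I_(k i)).

Definition diff_fun (x : V) : R^o := A i a x - A i b x.

Lemma diff_fun_linear : linear diff_fun.
Proof.
move=> c x y; rewrite /diff_fun !linearP /= -[RHS]/(c * (_ - _) + (_ - _)).
by rewrite -![_ *: _]/(_ * _); ring.
Qed.

HB.instance Definition _ := GRing.isLinear.Build R V R^o _ diff_fun diff_fun_linear.

Definition dform : 'Hom(V, R^o) := linfun diff_fun.

Lemma dformE x : dform x = A i a x - A i b x.
Proof. by rewrite lfunE. Qed.

Lemma dform_eq0 : (dform == 0) <-> A i a =1 A i b.
Proof.
split=> [/eqP/lfunP H x|H].
  by have := H x; rewrite dformE lfunE /= => /eqP; rewrite subr_eq0 => /eqP.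
by apply/eqP/lfunP => x; rewrite dformE lfunE /= H subrr.
Qed.
End DiffForm.

Definition top i (a : 'I_(k i)) (x : V) : bool := [forall c, A i c x <= A i a x].

(** Says that the unit is linear near [x]; indices carrying the same function may tie. *)
Definition smooth (i : 'I_m) (x : V) : bool :=
  [forall a : 'I_(k i), forall b : 'I_(k i), top a x ==> top b x ==> (dform a b == 0)].

Lemma top_exists i x : (0 < k i)%N -> exists a : 'I_(k i), top a x.
Proof.
move=> k0; pose a := [arg max_(c > Ordinal k0) A i c x]%O.
exists a; apply/forallP => c; rewrite /a; case: arg_maxP => //= b _; exact.
Qed.

Lemma top_eq i (a b : 'I_(k i)) x : top a x -> top b x -> A i a x = A i b x.
Proof.
by move=> /forallP ta /forallP tb; apply/eqP; rewrite eq_le ta tb.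
Qed.

Lemma maxout_pieceP i (a b : 'I_(k i)) x :
  maxout_piece A a b x <-> top a x /\ top b x.
Proof.
split=> [[ab bmax]|[ta tb]].
  have ta : top a x by apply/forallP => c; rewrite ab bmax le_bigmax.
  by split=> //; apply/forallP => c; rewrite -ab; apply: (forallP ta).
split; first exact: top_eq.
rewrite (top_eq tb ta); apply/esym/le_anti/andP; split; last first.
  exact: bigmax_ge_id.
by apply/bigmax_leP; split=> // c _; exact: (forallP ta).
Qed.

Lemma smoothP i x (a b : 'I_(k i)) :
  smooth i x -> top a x -> top b x -> A i a =1 A i b.
Proof.
by move=> /forallP/(_ a)/forallP/(_ b) + ta tb; rewrite ta tb => /dform_eq0.
Qed.

Lemma ntop_lt i (a c : 'I_(k i)) x : top a x -> ~~ top c x -> A i c x < A i a x.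
Proof.
move=> ta; rewrite lt_neqAle (forallP ta) andbT; apply: contraNneq => ca.
by apply/forallP => b; rewrite ca; apply: (forallP ta).
Qed.

(** A common step for finitely many directions yields the affinely independent points that [affdim]
    asks for. *)
Lemma lt_perturb i (a : 'I_(k i)) (P : pred 'I_(k i)) x e (v : 'I_e -> V) :
  (forall c, P c -> A i c x < A i a x) ->
  exists2 h : R, 0 < h & forall c t, P c ->
    A i c (x + h *: v t) < A i a (x + h *: v t).
Proof.
move=> Hx; have [|h h0 Hh] := @sg_perturb_all R _
    [seq u <- enum {: 'I_(k i) * 'I_e} | P u.1]
    (fun u => A i a x - A i u.1 x)
    (fun u => A i a (v u.2) - A i u.1 (v u.2)).
  by move=> u; rewrite mem_filter => /andP[/Hx + _]; rewrite -subr_gt0 => /lt0r_neq0.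
exists h => // c t Pc; rewrite -subr_gt0 -sgr_cp0.
have {Hh} := Hh (c, t) _ h; rewrite mem_filter mem_enum Pc => /(_ isT).
rewrite gtr0_norm // => /(_ (lexx _)) /=.
rewrite [X in _ = X]gtr0_sg ?subr_gt0 ?Hx // => <-.
rewrite !linearD !linearZ /= -[h *: _]/(h * _); apply/eqP; congr Num.sg; ring.
Qed.

(** If a new form vanishes at [y], a small move along some [z] outside its kernel keeps the earlier
    forms nonzero. *)
Lemma generic_point (r : seq 'Hom(V, R^o)) : {in r, forall l, l != 0} ->
  exists y, {in r, forall l : 'Hom(V, R^o), l y != 0}.
Proof.
elim: r => [|l r IHr] Hr; first by exists 0.
have [|y Hy] := IHr; first by move=> l' l'r; apply: Hr; rewrite inE l'r orbT.
have [ly|ly] := eqVneq (l y) 0; last first.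
  by exists y => l'; rewrite inE => /predU1P[->|/Hy].
have [z lz] := hom_neq0 (Hr _ (mem_head _ _)).
have [e e0 He] := @sg_perturb_all R _ _ _ (fun l : 'Hom(V, R^o) => l z) Hy.
exists (y + e *: z) => l'; rewrite inE linearD linearZ /= => /predU1P[->|l'r].
  by rewrite ly add0r scaler_eq0 negb_or (gt_eqF e0).
by rewrite -(sgr_eq0 (_ : R)) He ?gtr0_norm // sgr_eq0 Hy.
Qed.

(** At a smooth point all top functions coincide and the others stay below nearby, so a piece
    through it contains small moves along all unit vectors and has codimension 0. *)
Lemma atom_not_smooth i H x : atoms A i H -> H x -> ~~ smooth i x.
Proof.
move=> [a [b [_ cod ->]]] /maxout_pieceP[ta tb]; apply/negP => sm.
have [c|h h0 Hh] := @lt_perturb i a [pred c | ~~ top c x] x d (fun t => row t 1%:M).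
  exact: ntop_lt.
have ab := smoothP sm ta tb.
suff /leq_trans : (d <= affdim (maxout_piece A a b))%N.
  by move: cod; rewrite /codim => + /(_ _ (leqnn _)); rewrite -subn_eq0 => ->.
apply: (@affdim_ge _ _ _ _ x (h *: 1%:M)).
- exact/maxout_pieceP.
- move=> t; apply/maxout_pieceP.
  have ta' : top a (x + row t (h *: 1%:M)).
    apply/forallP => c; rewrite linearZ /=.
    have [tc|tc] := boolP (top c x); first by rewrite (smoothP sm tc ta).
    exact/ltW/Hh.
  by split=> //; apply/forallP => c; rewrite -ab; apply: (forallP ta').
- by rewrite /row_free mxrank_scale_nz ?lt0r_neq0 // mxrank1.
Qed.

(* Among the functions that attain the maximum at [x], take one, [A i a], whose
   cone of dominance is full-dimensional.  A facet of that cone spans a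
   hyperplane [A i a = A i b], and the atom of [a] and [b] contains a
   translate of a piece of this facet. *)
Lemma not_smooth_atom i x : (0 < k i)%N -> ~~ smooth i x ->
  exists2 H, atoms A i H & H x.
Proof.
move=> k0 nsm.
have [y Hy] : exists y, forall a b : 'I_(k i), dform a b != 0 -> A i a y != A i b y.
  have [|y Hy] := @generic_point
    [seq l <- [seq dform u.1 u.2 | u <- enum {: 'I_(k i) * 'I_(k i)}] | l != 0].
    by move=> l; rewrite mem_filter => /andP[].
  exists y => a b ab; rewrite -subr_eq0 -[_ - _]dformE; apply: Hy.
  rewrite mem_filter ab; apply/mapP; exists (a, b) => //.
  by rewrite mem_enum.
have [a0 ta0] := top_exists x k0.
(* The generic [y] breaks the ties at [x]: [A i a] strictly exceeds at [y] every other function that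
   is top at [x]. *)
pose a := [arg max_(c > a0 | top c x) A i c y]%O.
have [ta amax] : top a x /\ forall c, top c x -> A i c y <= A i a y.
  by rewrite /a; case: arg_maxP => // b tb bmax; split.
pose M := [set c | top c x && (dform a c != 0)].
have MP c : c \in M -> [/\ top c x, A i c x = A i a x & A i c y < A i a y].
  rewrite inE => /andP[tc ac]; split=> //; first exact: top_eq.
  by rewrite lt_neqAle amax // andbT eq_sym Hy.
have [c1 c1M] : exists c, c \in M.
  apply: contrapT => M0; move/negP: nsm; apply.
  have eqa c : top c x -> A i a =1 A i c.
    move=> tc; apply/dform_eq0/eqP; apply: contrapT => /eqP ac.
    by apply: M0; exists c; rewrite inE tc.
  apply/forallP => b; apply/forallP => c; apply/implyP => tb; apply/implyP => tc.
  by apply/dform_eq0 => z; rewrite -(eqa b) // -(eqa c).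
pose dom (Q : {set 'I_(k i)}) v := forall c, c \in Q -> A i c v <= A i a v.
(* An irredundant subsystem [Q] of the inequalities of [M]; each of its members bounds a facet. *)
have [Q /minsetP[/asboolP PQ Qmin] QM] :=
  @minset_exists _ [pred Q | `[< forall v, dom Q v -> dom M v >]] M
    (asboolT (fun v Hv => Hv)).
have [b bQ] : exists b, b \in Q.
  apply/set0Pn; apply: contraTneq c1M => Q0; apply/negP => c1M.
  have [_ _ c1y] := MP _ c1M; have : A i c1 (- y) <= A i a (- y).
    by apply: PQ c1M => c; rewrite Q0 inE.
  by rewrite !linearN lerN2 leNgt c1y.
(* By minimality, dropping [b] enlarges the cone; the new vector [v] violates the inequality of [b]
   alone among those of [Q]. *)
have [v [vB [c0 c0M c0v]]] : exists v, dom (Q :\ b) v /\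
    exists2 c, c \in M & A i a v < A i c v.
  apply: contrapT => nov.
  have : Q :\ b = Q.
    apply: Qmin; last exact: subD1set.
    apply/asboolP => v vB c cM; rewrite leNgt; apply/negP => cv.
    by apply: nov; exists v; split=> //; exists c.
  by move/setP/(_ b); rewrite !inE eqxx bQ.
have bv : A i a v < A i b v.
  rewrite ltNge; apply/negP => bv; move: c0v; rewrite ltNge => /negP; apply.
  apply: PQ c0M => c cQ; have [->//|cb] := eqVneq c b.
  by apply: vB; rewrite !inE cb.
have {}QM : {subset Q <= M} := fintype.subsetP QM.
have [tb bx by_] := MP _ (QM _ bQ).
(* Up to scale, the point where the segment from [v] to [y] meets [A i a = A i b]. The rest of [Q]
   is weak at [v] and strict at [y], hence strict here. *)
pose v0 := (A i a y - A i b y) *: v + (A i b v - A i a v) *: y.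
have v0E c : A i c v0 = (A i a y - A i b y) * A i c v + (A i b v - A i a v) * A i c y.
  by rewrite linearD !linearZ.
have bv0 : A i b v0 = A i a v0 by rewrite !v0E; ring.
have cv0 c : c \in Q :\ b -> A i c v0 < A i a v0.
  move=> cQ; have cv := vB _ cQ; move: cQ; rewrite 2!inE => /andP[_ cQ].
  have [_ _ cy] := MP _ (QM _ cQ); rewrite !v0E.
  by rewrite ler_ltD // ?ler_pM2l ?ltr_pM2l // ?subr_gt0.
have [c|h h0 Hh] := @lt_perturb i a [pred c | ~~ top c x] x 1 (fun=> v0).
  exact: ntop_lt.
pose q := x + h *: v0.
have qE c : A i c q = A i c x + h * A i c v0 by rewrite linearD linearZ.
pose N := [pred c | ~~ top c x || (c \in Q :\ b)].
have qN c : N c -> A i c q < A i a q.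
  move=> /orP[tc|cQ]; first exact: (Hh c 0).
  have [|_ cx _] := MP c; first by apply: QM; case/setD1P: cQ.
  by rewrite !qE cx ltrD2l ltr_pM2l // cv0.
have pieceN z : A i b z = A i a z -> (forall c, N c -> A i c z < A i a z) ->
    maxout_piece A a b z.
  move=> bz cz; apply/maxout_pieceP.
  have taz : top a z.
    apply/forallP => c; have [tc|tc] := boolP (top c x); last first.
      by rewrite ltW // cz //= tc.
    have [/eqP/dform_eq0 ->//|ac] := eqVneq (dform a c) 0.
    apply: (PQ z); last by rewrite inE tc.
    move=> c' c'Q; have [->|c'b] := eqVneq c' b; first by rewrite bz.
    by rewrite ltW // cz //= !inE c'b c'Q orbT.
  by split=> //; apply/forallP => c; rewrite bz; apply: (forallP taz).
have ab0 : dform a b != 0.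
  by move: (QM _ bQ); rewrite inE => /andP[].
pose K := row_base (kermx (coeffs (dform a b))).
(* Small moves of [q] along the basis [K] of the hyperplane stay in the piece, which gives dimension
   at least [d.-1]. *)
have [h' h'0 Hh'] := lt_perturb (fun t => row t K) qN.
have bq : A i b q = A i a q by rewrite !qE bx bv0.
have Kab t : A i b (row t K) = A i a (row t K).
  have : K *m coeffs (dform a b) = 0.
    by apply/sub_kermxP; rewrite eq_row_base.
  rewrite coeffsE => /colP/(_ t); rewrite !mxE dformE.
  by move/eqP; rewrite subr_eq0 => /eqP.
exists (maxout_piece A a b); last exact/maxout_pieceP.
exists a, b; split=> //.
  by apply: contra_neq ab0 => ->; apply/eqP/dform_eq0.
have rK : \rank (kermx (coeffs (dform a b))) = d.-1.
  by rewrite mxrank_ker rank_coeffs // subn1.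
have d0 : (0 < d)%N by rewrite -(rank_coeffs ab0) rank_leq_row.
rewrite /codim (_ : affdim _ = d.-1); first by case: (d) d0 => // d' _; rewrite subSnn.
apply/eqP; rewrite eqn_leq; apply/andP; split.
  apply: affdim_hyperplane ab0 _ => z /maxout_pieceP[taz tbz].
  by rewrite dformE (top_eq taz tbz) subrr.
rewrite -{1}rK; apply: (@affdim_ge _ _ _ _ q (h' *: K)).
- exact: pieceN.
- move=> t; rewrite linearZ /=; apply: pieceN => [|c Nc]; last exact: Hh'.
  by rewrite [LHS]linearD [RHS]linearD !linearZ /= bq Kab.
- by rewrite /row_free mxrank_scale_nz ?lt0r_neq0 // eq_row_base.
Qed.

End Units.

(** * Regions as open convex cells *)

Section Regions.
Variables (R : realType) (n m : nat) (k : 'I_m -> nat).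
Variable A : forall i : 'I_m, 'I_(k i) -> {scalar 'rV[R]_n.+1}.
Hypothesis kpos : forall i, (0 < k i)%N.

Local Notation V := 'rV[R]_n.+1.
Local Notation pairs := {i : 'I_m & ('I_(k i) * 'I_(k i))%type}.

Implicit Types (S : {set 'I_m}) (x y : V).

Definition forms : seq 'Hom(V, R^o) :=
  [seq dform A (tagged u).1 (tagged u).2 | u <- enum {: pairs}].

Definition smooth_on S x : bool := [forall i in S, smooth A i x].

Definition labels S x : {set {i : 'I_m & 'I_(k i)}} :=
  [set u | (tag u \in S) && top A (tagged u) x].

(** Only strict inequalities occur: at a smooth point ties are identities. *)
Definition cell_system S x : seq ('Hom(V, R^o) * R) :=
  [seq (dform A (tagged u).1 (tagged u).2, 1) | u <- enum {: pairs} &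
    [&& tag u \in S, top A (tagged u).1 x & ~~ top A (tagged u).2 x]].

Lemma labelsP S x i (a : 'I_(k i)) : i \in S ->
  (Tagged (fun i => 'I_(k i)) a \in labels S x) = top A a x.
Proof. by move=> iS; rewrite inE /= iS. Qed.

Lemma sat_cell_systemP S x y : reflect
  (forall i (a b : 'I_(k i)), i \in S -> top A a x -> ~~ top A b x -> A b y < A a y)
  (sat (cell_system S x) y).
Proof.
apply: (iffP allP) => [H i a b iS ta tb|H c /mapP[[i [a b]]]].
  suff /H /= : (dform A a b, 1) \in cell_system S x.
    by rewrite dformE sgr_cp0 subr_gt0.
  pose u : pairs := Tagged (fun i => ('I_(k i) * 'I_(k i))%type) (a, b).
  by apply/mapP; exists u => //; rewrite mem_filter /= iS ta tb mem_enum.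
rewrite mem_filter /= => /andP[/and3P[iS ta tb] _] -> /=.
by rewrite dformE sgr_cp0 subr_gt0 H.
Qed.

Lemma cell_systemE S x y : smooth_on S x ->
  sat (cell_system S x) y = smooth_on S y && (labels S y == labels S x).
Proof.
move=> /forall_inP sx; apply/sat_cell_systemP/andP => [H|[sy /eqP eqL] i a b iS ta tb].
  have topE i (c : 'I_(k i)) : i \in S -> top A c y = top A c x.
    move=> iS; have [a ta] := top_exists A x (kpos i).
    have [tc|tc] := boolP (top A c x).
      apply/forallP => b; have [tb|tb] := boolP (top A b x); last exact/ltW/H.
      by rewrite (smoothP (sx _ iS) tb tc).
    by apply/negP => /forallP/(_ a); rewrite leNgt H.
  split.
    apply/forall_inP => i iS; apply/forallP => a; apply/forallP => b.
    rewrite !topE //; apply/implyP => ta; apply/implyP => tb.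
    exact/dform_eq0/(smoothP (sx _ iS)).
  by apply/eqP/setP => -[i c]; rewrite !inE /=; case: (boolP (i \in S)) => //= /topE ->.
by apply: ntop_lt; rewrite -(labelsP _ _ iS) eqL labelsP.
Qed.

Lemma scalar_continuous (l : 'Hom(V, R^o)) : continuous (fun x : V => l x : R).
Proof.
move=> x; pose g (y : V) : R := \sum_(j < n.+1) y 0 j * (l (delta_mx 0 j) : R).
have gE : (fun y : V => l y : R) = g.
  apply/funext => y; rewrite {1}[y]row_sum_delta linear_sum /=.
  by apply: eq_bigr => j _; rewrite linearZ.
rewrite gE; have cb := @cvg_big R _ +%R 0 xpredT (@add_continuous R) V (nbhs x)
  (index_enum 'I_n.+1) (fun j (y : V) => y 0 j * (l (delta_mx 0 j) : R))
  (fun j => x 0 j * (l (delta_mx 0 j) : R)) _.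
apply: cb => j _; apply: cvgMr_tmp.
exact: coord_continuous.
Qed.

Local Open Scope classical_set_scope.
Local Open Scope ring_scope.

Lemma open_sat (s : seq ('Hom(V, R^o) * R)) :
  {in s, forall c, c.2 = 1} -> open [set x | sat s x].
Proof.
elim: s => [|c s IHs] Hs.
  by rewrite [X in open X](_ : _ = [set: V]); [exact: openT | apply/seteqP; split].
rewrite [X in open X](_ : _ =
    [set x | 0 < (c.1 x : R)] `&` [set x | sat s x]).
  apply: openI; last by apply: IHs => c' c's; apply: Hs; rewrite inE c's orbT.
  apply: (@open_comp V R (fun x => c.1 x : R) [set r | 0 < r]); last exact: open_gt.
  by move=> x _; exact: scalar_continuous.
by apply/seteqP; split=> x /=; rewrite (Hs c (mem_head _ _)) sgr_cp0 => /andP.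
Qed.

Lemma cell_system1 S x : {in cell_system S x, forall c, c.2 = 1}.
Proof. by move=> c /mapP[u _ ->]. Qed.

(** By convexity the set is a union of segments from one of its points. *)
Lemma connected_sat (s : seq ('Hom(V, R^o) * R)) : connected [set x | sat s x].
Proof.
have [->|/set0P[x sx]] := eqVneq [set x | sat s x] set0; first exact: connected0.
pose f y (t : R) : V := (1 - t) *: x + t *: y.
have -> : [set x | sat s x] =
    \bigcup_(y in [set y | sat s y]) (f y @` `[0, 1]).
  apply/seteqP; split=> [y sy|z [y sy [t]]].
    exists y => //; exists 1; first by rewrite /= in_itv /= ler01 lexx.
    by rewrite /f subrr scale0r add0r scale1r.
  rewrite /= in_itv /= => /andP[]; rewrite !le_eqVlt => /predU1P[<-|t0].
    by move=> _ <-; rewrite /f subr0 scale1r scale0r addr0.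
  move=> /predU1P[->|t1] <-; first by rewrite /f subrr scale0r add0r scale1r.
  by apply: sat_convex => //; rewrite subr_gt0.
apply: bigcup_connected => [|y _].
  exists x => y _; exists 0; first by rewrite /= in_itv /= ler01 lexx.
  by rewrite /f subr0 scale1r scale0r addr0.
apply: connected_continuous_connected; first exact: segment_connected.
apply: continuous_subspaceT => t; apply: cvgD; last exact: scalel_continuous.
apply: (@continuous_comp _ _ _ (fun t : R => 1 - t) (fun t : R => t *: x)).
  by apply: cvgB; [exact: cvg_cst | exact: cvg_id].
exact: scalel_continuous.
Qed.

Definition cell S (L : {set {i : 'I_m & 'I_(k i)}}) : set V :=
  [set x | smooth_on S x && (labels S x == L)].

Lemma cellE S x : smooth_on S x ->
  cell S (labels S x) = [set y | sat (cell_system S x) y].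
Proof. by move=> sx; apply/seteqP; split=> y /=; rewrite cell_systemE. Qed.

Lemma open_cell S L : open (cell S L).
Proof.
have [->|/set0P[x /andP[sx /eqP <-]]] := eqVneq (cell S L) set0.
  exact: open0.
by rewrite cellE //; apply: open_sat; exact: cell_system1.
Qed.

(** Cells are connected, and since they are open and partition the smooth points, each is also
    relatively closed there. *)
Lemma component_cell S x : smooth_on S x ->
  connected_component [set y | smooth_on S y] x = cell S (labels S x).
Proof.
move=> sx; apply/seteqP; split; last first.
  apply: connected_component_max; rewrite /cell /= ?sx ?eqxx //.
    by move=> y /andP[].
  by rewrite -/(cell S (labels S x)) cellE //; exact: connected_sat.
set C := connected_component _ x.
have CW : (C `<=` [set y | smooth_on S y]) by exact: connected_component_sub.
rewrite -setIidPl; apply: (@component_connected _ _ x).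
- exists x; split; first exact: connected_component_refl.
  by rewrite /cell /= sx eqxx.
- by exists (cell S (labels S x)) => //; exact: open_cell.
- exists (~` \bigcup_(L in [set L | L != labels S x]) cell S L).
    by apply: open_closedC; apply: bigcup_open => L _; exact: open_cell.
  apply/seteqP; split=> y [Cy].
    by case/andP=> sy /eqP yx; split=> // -[L /= Lx /andP[_ /eqP yL]];
      rewrite -yL yx eqxx in Lx.
  move=> nL; split=> //; have sy := CW _ Cy; rewrite /cell /= sy /=.
  apply/negPn/negP => yx; apply: nL; exists (labels S y) => //=.
  by rewrite /cell /= sy eqxx.
Qed.

Lemma arrangement_complement S :
  (~` \bigcup_(H in arrangement A S) H) = [set x | smooth_on S x].
Proof.
apply/seteqP; split=> x /=.
  move=> nx; apply/forall_inP => i iS; apply/negPn/negP.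
  by move=> /(not_smooth_atom (kpos i))[H Hi Hx]; apply: nx; exists H => //; exists i.
move=> /forall_inP sx [H [i iS Hi] Hx].
by have /negP := atom_not_smooth Hi Hx; apply; exact: sx.
Qed.

Definition cell_labels S : {set {set {i : 'I_m & 'I_(k i)}}} :=
  [set L | `[< exists2 x, smooth_on S x & labels S x = L >]]%SET.

Lemma nregionsE S : nregions A S = #|cell_labels S|.
Proof.
rewrite /nregions arrangement_complement /ncomponents.
pose E := [fset L in enum (cell_labels S)]%fset.
have EP L : reflect (exists2 x, smooth_on S x & labels S x = L) (L \in E).
  by rewrite !inE mem_enum inE; exact: asboolP.
have -> : [set connected_component [set y | smooth_on S y] x
    | x in [set y | smooth_on S y]] = (cell S @` [set` E]).
  apply/seteqP; split=> [_ [x sx <-]|_ [_ /EP[x sx <-] <-]].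
    exists (labels S x); last by rewrite component_cell.
    by apply/EP; exists x.
  by exists x; rewrite // component_cell.
rewrite fset_set_image; last exact: finite_fset.
have cE : #|` E|%fset = #|cell_labels S|.
  by rewrite card_fseq undup_id ?enum_uniq // -cardE.
rewrite set_fsetK -cE.
apply/eqP/card_in_imfsetP => L1 L2 /EP[x sx <-] _ eqc.
have : cell S (labels S x) x by rewrite /cell /= sx eqxx.
by rewrite eqc => /andP[_ /eqP].
Qed.

Lemma nregions_euler S :
  (-1) ^+ n.+1 * (nregions A S)%:Z = euler forms (smooth_on S).
Proof.
(* Faces are grouped by the cell that contains them; each group sums to the weight of an open cone
   of dimension [n.+1]. *)
rewrite /euler (partition_big (fun f => labels S (face_point f))
  (mem (cell_labels S))) /=; last first.
  by move=> f sf; rewrite inE; apply/asboolP; exists (face_point f).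
rewrite nregionsE -sum1_card -natz natr_sum mulr_sumr; apply: eq_bigr => L.
rewrite inE mulr1 => /asboolP[x sx <-].
transitivity (cone_weight (cell_system S x)).
  rewrite (@cone_weight_sat _ _ _ x) ?cell_systemE ?sx ?eqxx //.
  have -> : zero_space (cell_system S x) = fullv.
    apply/eqP; rewrite eqEsubv subvf; apply/subvP => y _.
    by apply/zero_spaceP => c /cell_system1 -> /eqP; rewrite oner_eq0.
  by rewrite dimvf dim_matrix mul1r.
rewrite -(@euler_sat _ _ forms); last first.
  move=> _ /mapP[_ /mapP[u _ ->] ->] /=; apply/mapP; exists u => //.
  by rewrite mem_enum.
by apply: eq_bigl => f; rewrite cell_systemE.
Qed.

End Regions.

(** * Simplicity and the face-by-face comparison *)

(** Atoms of [n.+1] different units through a nonzero [x] would meet in a set containing 0 and [x],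
    whose codimension is at most [n]. *)
Lemma simple_nonsmooth_eq0 (R : realType) (n m : nat) (k : 'I_m -> nat)
    (A : forall i : 'I_m, 'I_(k i) -> {scalar 'rV[R]_n.+1}) (x : 'rV[R]_n.+1) :
  (forall i, (0 < k i)%N) -> simple_arrangement A ->
  (n < #|[set i | ~~ smooth A i x]%SET|)%N -> x = 0.
Proof.
move=> kpos simple nN; set N := [set i | _]%SET in nN.
pose u (t : 'I_n.+1) : 'I_m := enum_val (widen_ord nN t).
have uinj : injective u by move=> s t /enum_val_inj /(congr1 val) /= /val_inj.
have /choice[H Hu] : forall t, exists H, atoms A (u t) H /\ H x.
  move=> t; have : u t \in N by exact: enum_valP.
  by rewrite inE => /(not_smooth_atom (kpos _))[H ? ?]; exists H.
have [K0|codK] := simple _ u H uinj (fun t => (Hu t).1).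
  have : (\bigcap_(t in [set: 'I_n.+1]) H t)%classic x by move=> t _; exact: (Hu t).2.
  by rewrite K0.
apply: contrapT => /eqP x0.
suff : (1 <= affdim (\bigcap_(t in [set: 'I_n.+1]) H t)%classic)%N.
  by move: codK; rewrite /codim; lia.
have xfree : row_free x by rewrite /row_free rank_rV x0.
apply: (@affdim_ge _ _ _ _ 0 x) => // [t _|s t _].
  have [[a [b [_ _ ->]]] _] := Hu t.
  by apply/maxout_pieceP; split; apply/forallP => c; rewrite !linear0.
by rewrite add0r ord1 row_id; exact: (Hu t).2.
Qed.

Theorem theorem6p3 (R : realType) (n m : nat) (k : 'I_m -> nat)
    (A : forall i : 'I_m, 'I_(k i) -> {scalar 'rV[R]_n.+1})
    (hm : (n.+1 <= m)%N)
    (hk : forall i, (2 <= k i)%N)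
    (hA : forall i, ~ (forall a b : 'I_(k i), A i a =1 A i b))
    (hsimple : simple_arrangement A) :
  (nregions A [set: 'I_m]%SET)%:Z =
    'C(m.-1, n)%:Z +
    \sum_(j < n.+1) (-1) ^+ (n - j) * 'C(m.-1 - j, n - j)%:Z *
      \sum_(S : {set 'I_m} | #|S| == j) (nregions A S)%:Z.
Proof.
have kpos i : (0 < k i)%N by exact: ltnW.
pose smooths (x : 'rV[R]_n.+1) := [set i | smooth A i x]%SET.
have smooths_le x : (#|smooths x| <= m)%N by rewrite -[leqRHS]card_ord max_card.
have few_nonsmooth x : x != 0 -> (m - n <= #|smooths x|)%N.
  apply: contraNleq => small; apply/eqP.
  apply: (simple_nonsmooth_eq0 kpos hsimple).
  have -> : [set i | ~~ smooth A i x]%SET = ~: smooths x.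
    by apply/setP => i; rewrite !inE.
  have := cardsC (smooths x); rewrite card_ord; lia.
have smooths0 (x : 'rV[R]_n.+1) :
    (forall i (a b : 'I_(k i)), A i a x = A i b x) -> smooths x = finset.set0.
  move=> tie; apply/setP => i; rewrite !inE; apply/negP => sx.
  have topx (a : 'I_(k i)) : top A a x by apply/forallP => c; rewrite (tie _ c a).
  by apply: (hA i) => a b; exact: smoothP sx _ _.
(* No unit is smooth at such an [x], whereas a nonzero point has at least [m - n > 0] smooth
   units. *)
have tie0 (x : 'rV[R]_n.+1) :
    (forall i (a b : 'I_(k i)), A i a x = A i b x) -> x = 0.
  move=> /smooths0 sx; apply/eqP; apply: contraLR hm => /few_nonsmooth.
  by rewrite sx cards0; lia.
(* The origin is the face with all signs zero, of dimension 0. *)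
have euler0 : euler (forms A) (fun x => x == 0) = 1.
  pose s0 : seq ('Hom('rV[R]_n.+1, R^o) * R) := [seq (l, 0) | l <- forms A].
  have s0P x : (forall l, l \in forms A -> l x = 0) -> x = 0.
    move=> lx; apply: tie0 => i a b; apply/eqP; rewrite -subr_eq0 -dformE lx //.
    pose u : {i : 'I_m & ('I_(k i) * 'I_(k i))%type} :=
      Tagged (fun i => ('I_(k i) * 'I_(k i))%type) (a, b).
    by apply/mapP; exists u; rewrite ?mem_enum.
  have s0E x : sat s0 x = (x == 0).
    apply/allP/eqP => [sx|-> _ /mapP[l _ ->] /=]; last by rewrite linear0 sgr0.
    by apply: s0P => l lf; apply/eqP; have := sx (l, 0) (map_f _ lf); rewrite /= sgr_eq0.
  transitivity (cone_weight s0).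
    rewrite -(@euler_sat _ _ (forms A)); first by apply: eq_bigl => f; rewrite s0E.
    by move=> _ /mapP[_ /mapP[l lf ->] ->].
  rewrite (@cone_weight_sat _ _ _ 0) ?s0E //.
  have -> : zero_space s0 = 0%VS; last by rewrite dimv0.
  apply/eqP; rewrite -subv0; apply/subvP => x /zero_spaceP sx; rewrite memv0.
  by apply/eqP/s0P => l lf; exact: (sx (l, 0) (map_f _ lf)).
pose weight (f : seq ('Hom('rV[R]_n.+1, R^o) * R)) : int :=
  (-1) ^+ n.+1 * cone_weight f.
have nregionsE S : (nregions A S)%:Z =
    \sum_(f <- faces (forms A)) weight f * (S \subset smooths (face_point f))%:Z.
  rewrite -[LHS](signrMK n.+1) (nregions_euler A kpos).
  rewrite /euler big_mkcond mulr_sumr; apply: eq_bigr => f _.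
  have -> : (S \subset smooths (face_point f)) = smooth_on A S (face_point f).
    by apply/fintype.subsetP/forall_inP => H i /H; rewrite inE.
  by rewrite /weight -mulrA; case: smooth_on; rewrite ?mulr1 ?mulr0.
pose coef j : int := (-1) ^+ (n - j) * 'C(m.-1 - j, n - j)%:Z.
(* A face is counted once for each [j]-element set of units smooth on it. *)
have levelE (j : nat) : \sum_(S : {set 'I_m} | #|S| == j) (nregions A S)%:Z =
    \sum_(f <- faces (forms A)) weight f * 'C(#|smooths (face_point f)|, j)%:Z.
  under eq_bigr do rewrite nregionsE.
  rewrite exchange_big; apply: eq_bigr => f _ /=; rewrite -mulr_sumr; congr (_ * _).
  rewrite -cards_draws -sum1_card -natz natr_sum [RHS]big_mkcond [LHS]big_mkcond.
  apply: eq_bigr => S _; rewrite inE andbC.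
  by case: ifP => //= _; case: (_ \subset _).
have pointwise (x : 'rV[R]_n.+1) : ([set: 'I_m]%SET \subset smooths x)%:Z =
    \sum_(j < n.+1) coef j * 'C(#|smooths x|, j)%:Z
    + (-1) ^+ n.+1 * 'C(m.-1, n)%:Z * (x == 0)%:Z.
  have -> : ([set: 'I_m]%SET \subset smooths x) = (#|smooths x| == m).
    by rewrite finset.subTset eqEcard finset.subsetT cardsT card_ord eqn_leq smooths_le.
  have [->|x0] := eqVneq x 0; last first.
    rewrite sum_signed_binomial_delta ?mulr0 ?addr0 //.
    by rewrite few_nonsmooth // smooths_le.
  (* At the origin no unit is smooth, so only [j = 0] survives; the last summand cancels it. *)
  rewrite smooths0 => [|i a b]; last by rewrite !linear0.
  rewrite cards0 big_ord_recl big1 => [|j _]; last by rewrite mulr0.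
  rewrite /coef !subn0 bin0 !mulr1 addr0 exprS ltn_eqF ?(leq_ltn_trans _ hm) //.
  by rewrite mulN1r mulNr subrr.
rewrite nregionsE.
under eq_bigr do rewrite pointwise mulrDr.
rewrite big_split /= addrC; congr (_ + _).
  (* The sign in [weight] and the sign of the correction multiply to 1. *)
  transitivity ('C(m.-1, n)%:Z * euler (forms A) (fun x => x == 0)); last first.
    by rewrite euler0 mulr1.
  rewrite /euler mulr_sumr [RHS]big_mkcond; apply: eq_bigr => f _.
  rewrite /weight; case: eqP => _; rewrite ?mulr0 // mulr1.
  by rewrite -mulrA mulrCA [cone_weight f * _]mulrC !mulrA -expr2 sqrr_sign; ring.
under [RHS]eq_bigr do rewrite levelE mulr_sumr.
rewrite exchange_big; apply: eq_bigr => f _ /=; rewrite mulr_sumr.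
by apply: eq_bigr => j _; rewrite mulrCA.
Qed.
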